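(* Let $A$ be an associative unital ring and let $\mathcal{C}$ be a coseparable $A$-coring. Then $\mathcal{C}$ is a separable $A$-ring, i.e. the $(A,A)$-bimodule $\mathcal{C}$ admits an associative $(A,A)$-bimodule product $\mu:\mathcal{C}\otimes_A\mathcal{C}\to\mathcal{C}$ making it a separable $A$-ring.
   Context: $A$ is an associative ring with unit. An $A$-coring is an $(A,A)$-bimodule $\mathcal{C}$ with $(A,A)$-bimodule maps $\Delta_{\mathcal{C}}:\mathcal{C}\to\mathcal{C}\otimes_A\mathcal{C}$ (coproduct) and $\epsilon_{\mathcal{C}}:\mathcal{C}\to A$ (counit) such that $(\Delta_{\mathcal{C}}\otimes I)\circ\Delta_{\mathcal{C}}=(I\otimes\Delta_{\mathcal{C}})\circ\Delta_{\mathcal{C}}$ and $(\epsilon_{\mathcal{C}}\otimes I)\circ\Delta_{\mathcal{C}}=I=(I\otimes\epsilon_{\mathcal{C}})\circ\Delta_{\mathcal{C}}$. $\mathcal{C}$ is a $(\mathcal{C},\mathcal{C})$-bicomodule via $\Delta_{\mathcal{C}}$, and $\mathcal{C}\otimes_A\mathcal{C}$ is a $(\mathcal{C},\mathcal{C})$-bicomodule with left coaction $\Delta_{\mathcal{C}}\otimes I$ and right coaction $I\otimes\Delta_{\mathcal{C}}$. The coring $\mathcal{C}$ is coseparable if there is a $(\mathcal{C},\mathcal{C})$-bicomodule map $\pi:\mathcal{C}\otimes_A\mathcal{C}\to\mathcal{C}$ with $\pi\circ\Delta_{\mathcal{C}}=I_{\mathcal{C}}$. An $A$-ring is an $(A,A)$-bimodule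 $B$ with an $(A,A)$-bimodule map $\mu:B\otimes_A B\to B$ which is associative, $\mu\circ(\mu\otimes I)=\mu\circ(I\otimes\mu)$ (no unit is required). An $A$-ring $B$ is separable if there is a $(B,B)$-bimodule map $\delta:B\to B\otimes_A B$ with $\mu\circ\delta=I_B$, where $B\otimes_A B$ has left $B$-action $\mu\otimes I$ and right $B$-action $I\otimes\mu$ (and all maps are $(A,A)$-bilinear). *)

(* Defs.v *)
From HB Require Import structures.
From mathcomp Require Import all_boot all_algebra.
From mathcomp Require Import boolp.
From mathcomp.multinomials Require Import freeg.

Set Implicit Arguments.
Unset Strict Implicit.
Unset Printing Implicit Defensive.

Import GRing.Theory.

Local Open Scope ring_scope.
Local Open Scope quotient_scope.

Reserved Notation "M ⊗ N" (at level 40, left associativity).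
Reserved Notation "x ⊗t y" (at level 40, left associativity).
Reserved Notation "f ⊗m g" (at level 40, left associativity).
Reserved Notation "{ 'bimod' M -> N }" (M at level 98, N at level 99,
  format "{ 'bimod'  M  ->  N }").

HB.mixin Record Lmodule_isBimodule (A : pzRingType) M of GRing.Lmodule A M := {
  rscale : M -> A -> M;
  rscalerA : forall (v : M) a b, rscale (rscale v a) b = rscale v (a * b);
  rscaler1 : forall v : M, rscale v 1 = v;
  rscalerDl : forall (u v : M) a, rscale (u + v) a = rscale u a + rscale v a;
  rscalerDr : forall (v : M) a b, rscale v (a + b) = rscale v a + rscale v b;
  scaler_rscale : forall a (v : M) b, rscale (a *: v) b = a *: rscale v b
}.

#[short(type="bimodType")]
HB.structure Definition Bimodule (A : pzRingType) :=
  {M of GRing.Lmodule A M & Lmodule_isBimodule A M}.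

Notation "x :* a" := (rscale x a) : ring_scope.

HB.mixin Record isRScalable (A : pzRingType) (M N : bimodType A)
    (f : M -> N) := {
  rlinearZ : forall x a, f (x :* a) = f x :* a
}.

HB.structure Definition BimodMap (A : pzRingType) (M N : bimodType A) :=
  {f of @GRing.Linear A M N *:%R f & isRScalable A M N f}.

Notation "{ 'bimod' M -> N }" := (BimodMap.type M%type N%type) : type_scope.

HB.instance Definition _ (A : pzRingType) (M : bimodType A) :=
  isRScalable.Build A M M idfun (fun _ _ => erefl).

Section CompBimod.
Variables (A : pzRingType) (M N P : bimodType A).
Variables (g : {bimod N -> P}) (f : {bimod M -> N}).
Fact comp_rlinearZ x a : (g \o f) (x :* a) = (g \o f) x :* a.
Proof. by rewrite /= !rlinearZ. Qed.
HB.instance Definition _ := isRScalable.Build A M P (g \o f) comp_rlinearZ.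
End CompBimod.

HB.instance Definition _ (A : pzRingType) :=
  @Lmodule_isBimodule.Build A A^o (fun (v : A) a => v * a)
    (fun v a b => esym (mulrA (v : A) a b)) (@mulr1 A)
    (@mulrDl A) (@mulrDr A)
    (fun a v b => esym (mulrA a (v : A) b)).

Section Tensor.
Variables (A : pzRingType) (M N : bimodType A).

(* The subgroup of the free abelian group on M * N by which one divides. *)
Inductive tensor_rel : {freeg (M * N)} -> Prop :=
| TensorRelDl m m' n :
    tensor_rel (<< (m + m', n) >> - (<< (m, n) >> + << (m', n) >>))
| TensorRelDr m n n' :
    tensor_rel (<< (m, n + n') >> - (<< (m, n) >> + << (m, n') >>))
| TensorRelM m a n : tensor_rel (<< (m :* a, n) >> - << (m, a *: n) >>)
| TensorRel0 : tensor_rel 0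
| TensorRelB x y : tensor_rel x -> tensor_rel y -> tensor_rel (x - y).

Definition tensor_ker : {pred {freeg (M * N)}} := fun x => `[< tensor_rel x >].

Fact tensor_ker_closed : zmod_closed tensor_ker.
Proof.
split=> [|x y]; rewrite !unfold_in; first exact/asboolP/TensorRel0.
by move=> /asboolP rx /asboolP ry; apply/asboolP/TensorRelB.
Qed.
HB.instance Definition _ :=
  GRing.isZmodClosed.Build {freeg (M * N)} tensor_ker tensor_ker_closed.

Definition tensor := Quotient.quot tensor_ker.
HB.instance Definition _ := GRing.Zmodule.on tensor.

Definition tens (m : M) (n : N) : tensor := \pi_tensor << (m, n) >>.

Lemma tensDl m m' n : tens (m + m') n = tens m n + tens m' n.
Proof.
rewrite /tens -raddfD; apply/eqP; rewrite -Quotient.idealrBE.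
exact/asboolP/TensorRelDl.
Qed.

Lemma tensDr m n n' : tens m (n + n') = tens m n + tens m n'.
Proof.
rewrite /tens -raddfD; apply/eqP; rewrite -Quotient.idealrBE.
exact/asboolP/TensorRelDr.
Qed.

Lemma tensM m a n : tens (m :* a) n = tens m (a *: n).
Proof.
by apply/eqP; rewrite -Quotient.idealrBE; apply/asboolP/TensorRelM.
Qed.

Lemma tens0l n : tens 0 n = 0.
Proof. by apply: (@addrI _ (tens 0 n)); rewrite -tensDl !addr0. Qed.

Lemma tensNl m n : tens (- m) n = - tens m n.
Proof. by apply: (@addrI _ (tens m n)); rewrite -tensDl !subrr tens0l. Qed.

Lemma tensor_ind (P : tensor -> Prop) :
  (forall m n, P (tens m n)) -> (forall x y, P x -> P y -> P (x + y)) ->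
  forall x, P x.
Proof.
move=> Pt PD x; rewrite -[x]reprK -[repr x]freeg_sumE raddf_sum /=.
have P0 : P 0 by rewrite -(tens0l 0).
have PN m n : P (- tens m n) by rewrite -tensNl.
elim/big_ind: _ => // -[m n] _.
have PMn k : P (tens m n *+ k).
  by elim: k => [|k IHk]; rewrite ?mulr0n // mulrS; apply: PD.
have PNMn k : P (- tens m n *+ k).
  by elim: k => [|k IHk]; rewrite ?mulr0n // mulrS; apply: PD.
have -> (k : int) : \pi_tensor << k *g (m, n) >> = tens m n *~ k.
  by rewrite -raddfMz freegU_mulz intz.
case: (coeff _ _) => k; first exact: PMn.
by rewrite NegzE mulrNz -mulNrz; apply: PNMn.
Qed.

Definition balanced (P : zmodType) (f : M -> N -> P) : Prop :=
  [/\ forall m m' n, f (m + m') n = f m n + f m' n,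
      forall m n n', f m (n + n') = f m n + f m n' &
      forall m a n, f (m :* a) n = f m (a *: n)].

Definition tlift (P : zmodType) (f : M -> N -> P) (x : tensor) : P :=
  fglift (fun p => f p.1 p.2 : zmodule P) (repr x).

Section Lift.
Variables (P : zmodType) (f : M -> N -> P).
Hypothesis fbal : balanced f.

Let F : {freeg (M * N)} -> P := fglift (fun p => f p.1 p.2 : zmodule P).

Let FB x y : F (x - y) = F x - F y.
Proof. exact: (@lift_is_additive int (M * N)%type (zmodule P)). Qed.

Let FD x y : F (x + y) = F x + F y.
Proof.
have F0 : F 0 = 0 by rewrite -[0 in LHS](subrr 0) FB subrr.
by rewrite -[y in LHS]opprK -[- y]add0r !FB F0 sub0r opprK.
Qed.

Let FU m n : F << (m, n) >> = f m n.
Proof. by rewrite /F liftU scale1r. Qed.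

Let F_ker x : tensor_rel x -> F x = 0.
Proof.
have [fDl fDr fM] := fbal.
elim=> [m m' n|m n n'|m a n||{}x y _ Fx _ Fy].
- by rewrite FB FD !FU fDl subrr.
- by rewrite FB FD !FU fDr subrr.
- by rewrite FB !FU fM subrr.
- by rewrite -[0 in LHS](subrr 0) FB subrr.
- by rewrite FB Fx Fy subrr.
Qed.

Let F_pi x : tlift f (\pi_tensor x) = F x.
Proof.
apply/eqP; rewrite -subr_eq0 -[X in X - _]/(F _) -FB; apply/eqP/F_ker/asboolP.
suff: repr (\pi_tensor x) - x \in tensor_ker by [].
by rewrite Quotient.idealrBE reprK.
Qed.

Lemma tlift_tens m n : tlift f (tens m n) = f m n.
Proof. by rewrite F_pi FU. Qed.

Lemma tliftD x y : tlift f (x + y) = tlift f x + tlift f y.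
Proof. by rewrite -[x]reprK -[y]reprK -raddfD !F_pi FD. Qed.

End Lift.

Lemma tensor_eq (P : zmodType) (f g : tensor -> P) :
  {morph f : x y / x + y} -> {morph g : x y / x + y} ->
  (forall m n, f (tens m n) = g (tens m n)) -> f =1 g.
Proof.
by move=> fD gD fg; apply: tensor_ind => // x y fx fy; rewrite fD gD fx fy.
Qed.

(* The outer A-actions: a (m ⊗ n) b = am ⊗ nb. *)
Fact tscale_balanced a : balanced (fun m n => tens (a *: m) n).
Proof.
split=> [m m' n|m n n'|m b n]; first by rewrite scalerDr tensDl.
  by rewrite tensDr.
by rewrite -tensM scaler_rscale.
Qed.

Fact trscale_balanced a : balanced (fun m n => tens m (n :* a)).
Proof.
split=> [m m' n|m n n'|m b n]; first by rewrite tensDl.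
  by rewrite rscalerDl tensDr.
by rewrite tensM scaler_rscale.
Qed.

Definition tscale a : tensor -> tensor := tlift (fun m n => tens (a *: m) n).
Definition trscale x a : tensor := tlift (fun m n => tens m (n :* a)) x.

Let tscaleD a : {morph tscale a : x y / x + y}.
Proof. exact: tliftD (tscale_balanced a). Qed.
Let trscaleD a : {morph trscale^~ a : x y / x + y}.
Proof. exact: tliftD (trscale_balanced a). Qed.
Let tscaleE a m n : tscale a (tens m n) = tens (a *: m) n.
Proof. exact: tlift_tens (tscale_balanced a) m n. Qed.
Let trscaleE a m n : trscale (tens m n) a = tens m (n :* a).
Proof. exact: tlift_tens (trscale_balanced a) m n. Qed.

Fact tscaleA a b x : tscale a (tscale b x) = tscale (a * b) x.
Proof.
elim/tensor_ind: x => [m n|x y IHx IHy]; first by rewrite !tscaleE scalerA.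
by rewrite !tscaleD IHx IHy.
Qed.

Fact tscale1 : left_id 1 tscale.
Proof.
elim/tensor_ind=> [m n|x y IHx IHy]; first by rewrite tscaleE scale1r.
by rewrite tscaleD IHx IHy.
Qed.

Fact tscaleDl x : {morph tscale^~ x : a b / a + b}.
Proof.
move=> a b; elim/tensor_ind: x => [m n|x y IHx IHy].
  by rewrite !tscaleE scalerDl tensDl.
by rewrite !tscaleD IHx IHy addrACA.
Qed.

HB.instance Definition _ := GRing.Zmodule_isLmodule.Build A tensor
  tscaleA tscale1 tscaleD tscaleDl.

Fact trscaleA x a b : trscale (trscale x a) b = trscale x (a * b).
Proof.
elim/tensor_ind: x => [m n|x y IHx IHy]; first by rewrite !trscaleE rscalerA.
by rewrite !trscaleD IHx IHy.
Qed.

Fact trscale1 x : trscale x 1 = x.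
Proof.
elim/tensor_ind: x => [m n|x y IHx IHy]; first by rewrite trscaleE rscaler1.
by rewrite trscaleD IHx IHy.
Qed.

Fact trscaleDr x a b : trscale x (a + b) = trscale x a + trscale x b.
Proof.
elim/tensor_ind: x => [m n|x y IHx IHy].
  by rewrite !trscaleE rscalerDr tensDr.
by rewrite !trscaleD IHx IHy addrACA.
Qed.

Fact tscale_trscale a x b : trscale (a *: x) b = a *: trscale x b.
Proof.
elim/tensor_ind: x => [m n|x y IHx IHy].
  by rewrite /GRing.scale/= !(tscaleE, trscaleE).
by rewrite scalerDr !trscaleD IHx IHy scalerDr.
Qed.

HB.instance Definition _ := Lmodule_isBimodule.Build A tensor
  trscaleA trscale1 (fun x y a => trscaleD a x y) trscaleDr tscale_trscale.

Lemma scale_tens a m n : a *: tens m n = tens (a *: m) n.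
Proof. exact: tscaleE. Qed.

Lemma rscale_tens m n a : tens m n :* a = tens m (n :* a).
Proof. exact: trscaleE. Qed.

End Tensor.

Notation "M ⊗ N" := (tensor M N) : type_scope.
Notation "x ⊗t y" := (tens x y) : ring_scope.

Section LiftBimod.
Variables (A : pzRingType) (M N P : bimodType A) (f : M -> N -> P).
Hypothesis fbal : balanced f.

Lemma tlift_linear : (forall a m n, f (a *: m) n = a *: f m n) -> linear (tlift f).
Proof.
move=> fZ a x y; rewrite (tliftD fbal); congr (_ + _).
elim/tensor_ind: x => [m n|{}x {}y IHx IHy].
  by rewrite scale_tens !(tlift_tens fbal).
by rewrite scalerDr !(tliftD fbal) IHx IHy scalerDr.
Qed.

Lemma tlift_rlinear : (forall m n a, f m (n :* a) = f m n :* a) ->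
  forall x a, tlift f (x :* a) = tlift f x :* a.
Proof.
move=> fZ x a; elim/tensor_ind: x => [m n|x y IHx IHy].
  by rewrite rscale_tens !(tlift_tens fbal).
by rewrite rscalerDl !(tliftD fbal) IHx IHy rscalerDl.
Qed.

End LiftBimod.

Section TensorMap.
Variables (A : pzRingType) (M M' N N' : bimodType A).
Variables (f : {bimod M -> M'}) (g : {bimod N -> N'}).

Definition tmap : M ⊗ N -> M' ⊗ N' := tlift (fun m n => f m ⊗t g n).

Fact tmap_balanced : balanced (fun m n => f m ⊗t g n).
Proof.
split=> [m m' n|m n n'|m a n]; first by rewrite raddfD tensDl.
  by rewrite raddfD tensDr.
by rewrite rlinearZ tensM linearZ.
Qed.

Lemma tmap_tens m n : tmap (m ⊗t n) = f m ⊗t g n.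
Proof. exact: tlift_tens tmap_balanced m n. Qed.

Fact tmap_linear : linear tmap.
Proof.
apply: (tlift_linear tmap_balanced) => a m n.
by rewrite linearZ scale_tens.
Qed.

Fact tmap_rlinear x a : tmap (x :* a) = tmap x :* a.
Proof.
apply: (tlift_rlinear tmap_balanced) => m n b.
by rewrite rlinearZ rscale_tens.
Qed.

HB.instance Definition _ :=
  GRing.isLinear.Build A (M ⊗ N) (M' ⊗ N') *:%R tmap tmap_linear.
HB.instance Definition _ :=
  isRScalable.Build A (M ⊗ N) (M' ⊗ N') tmap tmap_rlinear.

End TensorMap.

Notation "f ⊗m g" := (tmap f g) : ring_scope.

Section Associator.
Variables (A : pzRingType) (M N P : bimodType A).

Fact tassoc_balanced1 p : balanced (fun (m : M) (n : N) => m ⊗t (n ⊗t (p : P))).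
Proof.
split=> [m m' n|m n n'|m a n]; first by rewrite tensDl.
  by rewrite !(tensDl, tensDr).
by rewrite tensM scale_tens.
Qed.

(* (m ⊗ n) ⊗ p |-> m ⊗ (n ⊗ p) *)
Definition tassoc : (M ⊗ N) ⊗ P -> M ⊗ (N ⊗ P) :=
  tlift (fun x p => tlift (fun m n => m ⊗t (n ⊗t p)) x).

Fact tassoc_balanced :
  balanced (fun x p => tlift (fun (m : M) (n : N) => m ⊗t (n ⊗t (p : P))) x).
Proof.
split=> [x y p|x p q|x a p]; first exact: (tliftD (tassoc_balanced1 p)).
  elim/tensor_ind: x => [m n|x y IHx IHy].
    by rewrite !(tlift_tens (tassoc_balanced1 _)) !tensDr.
  by rewrite !(tliftD (tassoc_balanced1 _)) IHx IHy addrACA.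
elim/tensor_ind: x => [m n|x y IHx IHy].
  by rewrite rscale_tens !(tlift_tens (tassoc_balanced1 _)) tensM.
by rewrite rscalerDl !(tliftD (tassoc_balanced1 _)) IHx IHy.
Qed.

Lemma tassoc_tens m n p : tassoc ((m ⊗t n) ⊗t p) = m ⊗t (n ⊗t p).
Proof.
by rewrite /tassoc (tlift_tens tassoc_balanced) (tlift_tens (tassoc_balanced1 p)).
Qed.

Fact tassoc_linear : linear tassoc.
Proof.
apply: (tlift_linear tassoc_balanced) => a x p.
elim/tensor_ind: x => [m n|x y IHx IHy].
  by rewrite scale_tens !(tlift_tens (tassoc_balanced1 _)) scale_tens.
by rewrite scalerDr !(tliftD (tassoc_balanced1 _)) IHx IHy scalerDr.
Qed.

Fact tassoc_rlinear x a : tassoc (x :* a) = tassoc x :* a.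
Proof.
apply: (tlift_rlinear tassoc_balanced) => {}x p {}a.
elim/tensor_ind: x => [m n|x y IHx IHy].
  by rewrite !(tlift_tens (tassoc_balanced1 _)) !rscale_tens.
by rewrite !(tliftD (tassoc_balanced1 _)) IHx IHy rscalerDl.
Qed.

HB.instance Definition _ :=
  GRing.isLinear.Build A ((M ⊗ N) ⊗ P) (M ⊗ (N ⊗ P)) *:%R tassoc tassoc_linear.
HB.instance Definition _ :=
  isRScalable.Build A ((M ⊗ N) ⊗ P) (M ⊗ (N ⊗ P)) tassoc tassoc_rlinear.

Fact tassocV_balanced1 m : balanced (fun (n : N) (p : P) => ((m : M) ⊗t n) ⊗t p).
Proof.
split=> [n n' p|n p p'|n a p]; first by rewrite !(tensDl, tensDr).
  by rewrite tensDr.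
by rewrite -rscale_tens tensM.
Qed.

(* m ⊗ (n ⊗ p) |-> (m ⊗ n) ⊗ p *)
Definition tassocV : M ⊗ (N ⊗ P) -> (M ⊗ N) ⊗ P :=
  tlift (fun m y => tlift (fun n p => (m ⊗t n) ⊗t p) y).

Fact tassocV_balanced :
  balanced (fun m y => tlift (fun (n : N) (p : P) => ((m : M) ⊗t n) ⊗t p) y).
Proof.
split=> [m m' y|m y z|m a y]; last first.
- elim/tensor_ind: y => [n p|y z IHy IHz].
    by rewrite scale_tens !(tlift_tens (tassocV_balanced1 _)) tensM.
  by rewrite scalerDr !(tliftD (tassocV_balanced1 _)) IHy IHz.
- exact: (tliftD (tassocV_balanced1 m)).
elim/tensor_ind: y => [n p|y z IHy IHz].
  by rewrite !(tlift_tens (tassocV_balanced1 _)) !tensDl.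
by rewrite !(tliftD (tassocV_balanced1 _)) IHy IHz addrACA.
Qed.

Lemma tassocV_tens m n p : tassocV (m ⊗t (n ⊗t p)) = (m ⊗t n) ⊗t p.
Proof.
by rewrite /tassocV (tlift_tens tassocV_balanced)
  (tlift_tens (tassocV_balanced1 m)).
Qed.

Fact tassocV_linear : linear tassocV.
Proof.
apply: (tlift_linear tassocV_balanced) => a m y.
elim/tensor_ind: y => [n p|y z IHy IHz].
  by rewrite !(tlift_tens (tassocV_balanced1 _)) !scale_tens.
by rewrite !(tliftD (tassocV_balanced1 _)) IHy IHz scalerDr.
Qed.

Fact tassocV_rlinear x a : tassocV (x :* a) = tassocV x :* a.
Proof.
apply: (tlift_rlinear tassocV_balanced) => m y {}a.
elim/tensor_ind: y => [n p|y z IHy IHz].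
  by rewrite rscale_tens !(tlift_tens (tassocV_balanced1 _)) rscale_tens.
by rewrite rscalerDl !(tliftD (tassocV_balanced1 _)) IHy IHz rscalerDl.
Qed.

HB.instance Definition _ :=
  GRing.isLinear.Build A (M ⊗ (N ⊗ P)) ((M ⊗ N) ⊗ P) *:%R tassocV tassocV_linear.
HB.instance Definition _ :=
  isRScalable.Build A (M ⊗ (N ⊗ P)) ((M ⊗ N) ⊗ P) tassocV tassocV_rlinear.

Lemma tassocK : cancel tassoc tassocV.
Proof.
elim/tensor_ind=> [x p|x y IHx IHy]; last by rewrite !raddfD /= IHx IHy.
elim/tensor_ind: x => [m n|x y IHx IHy]; first by rewrite tassoc_tens tassocV_tens.
by rewrite tensDl !raddfD /= IHx IHy.
Qed.

Lemma tassocVK : cancel tassocV tassoc.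
Proof.
elim/tensor_ind=> [m y|x y IHx IHy]; last by rewrite !raddfD /= IHx IHy.
elim/tensor_ind: y => [n p|x y IHx IHy]; first by rewrite tassocV_tens tassoc_tens.
by rewrite tensDr !raddfD /= IHx IHy.
Qed.

End Associator.

Section Unitors.
Variables (A : pzRingType) (M : bimodType A).

(* a ⊗ m |-> am and m ⊗ a |-> ma *)
Definition tunitl : A^o ⊗ M -> M := tlift (fun (a : A^o) (m : M) => (a : A) *: m).
Definition tunitr : M ⊗ A^o -> M := tlift (fun (m : M) (a : A^o) => m :* a).

Fact tunitl_balanced : balanced (fun (a : A^o) (m : M) => (a : A) *: m).
Proof.
split=> [a b m|a m n|a b m]; [exact: scalerDl|exact: scalerDr|].
by rewrite scalerA.
Qed.

Fact tunitr_balanced : balanced (fun (m : M) (a : A^o) => m :* a).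
Proof.
split=> [m n a|m a b|m b a]; [exact: rscalerDl|exact: rscalerDr|].
by rewrite rscalerA.
Qed.

Lemma tunitl_tens a m : tunitl (a ⊗t m) = (a : A) *: m.
Proof. exact: (tlift_tens tunitl_balanced). Qed.

Lemma tunitr_tens m a : tunitr (m ⊗t a) = m :* (a : A).
Proof. exact: (tlift_tens tunitr_balanced). Qed.

Fact tunitl_linear : linear tunitl.
Proof. by apply: (tlift_linear tunitl_balanced) => a b m; rewrite scalerA. Qed.

Fact tunitl_rlinear x a : tunitl (x :* a) = tunitl x :* a.
Proof.
by apply: (tlift_rlinear tunitl_balanced) => b m c; rewrite scaler_rscale.
Qed.

Fact tunitr_linear : linear tunitr.
Proof.
by apply: (tlift_linear tunitr_balanced) => a m b; rewrite scaler_rscale.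
Qed.

Fact tunitr_rlinear x a : tunitr (x :* a) = tunitr x :* a.
Proof. by apply: (tlift_rlinear tunitr_balanced) => m b c; rewrite rscalerA. Qed.

HB.instance Definition _ :=
  GRing.isLinear.Build A (A^o ⊗ M) M *:%R tunitl tunitl_linear.
HB.instance Definition _ := isRScalable.Build A (A^o ⊗ M) M tunitl tunitl_rlinear.
HB.instance Definition _ :=
  GRing.isLinear.Build A (M ⊗ A^o) M *:%R tunitr tunitr_linear.
HB.instance Definition _ := isRScalable.Build A (M ⊗ A^o) M tunitr tunitr_rlinear.

End Unitors.

HB.mixin Record Bimodule_isCoring (A : pzRingType) C of Bimodule A C := {
  comul : {bimod C -> C ⊗ C};
  counit : {bimod C -> A^o};
  comulA : forall c : C,
    tassoc ((comul ⊗m idfun) (comul c)) = (idfun ⊗m comul) (comul c);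
  counitl : forall c : C, tunitl ((counit ⊗m idfun) (comul c)) = c;
  counitr : forall c : C, tunitr ((idfun ⊗m counit) (comul c)) = c
}.

#[short(type="coringType")]
HB.structure Definition Coring (A : pzRingType) :=
  {C of Bimodule A C & Bimodule_isCoring A C}.

Section Coseparable.
Variables (A : pzRingType) (C : coringType A).

Definition left_colinear (M N : bimodType A) (rhoM : M -> C ⊗ M)
    (rhoN : N -> C ⊗ N) (f : {bimod M -> N}) : Prop :=
  forall x, rhoN (f x) = (idfun ⊗m f) (rhoM x).

Definition right_colinear (M N : bimodType A) (rhoM : M -> M ⊗ C)
    (rhoN : N -> N ⊗ C) (f : {bimod M -> N}) : Prop :=
  forall x, rhoN (f x) = (f ⊗m idfun) (rhoM x).

(* The outer coactions on C ⊗ C, bracketed as C ⊗ (C ⊗ C) and (C ⊗ C) ⊗ C. *)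
Definition lcoact2 : C ⊗ C -> C ⊗ (C ⊗ C) := fun x => tassoc ((comul ⊗m idfun) x).
Definition rcoact2 : C ⊗ C -> (C ⊗ C) ⊗ C := fun x => tassocV ((idfun ⊗m comul) x).

Definition coseparable : Prop :=
  exists pi : {bimod C ⊗ C -> C},
    [/\ left_colinear lcoact2 comul pi,
        right_colinear rcoact2 comul pi &
        forall c : C, pi (comul c) = c].

End Coseparable.

(* An A-ring is (B, mu) with mu associative; no unit is required. *)
Section SeparableRing.
Variables (A : pzRingType) (B : bimodType A) (mu : {bimod B ⊗ B -> B}).

Definition is_Aring : Prop :=
  forall x : (B ⊗ B) ⊗ B, mu ((mu ⊗m idfun) x) = mu ((idfun ⊗m mu) (tassoc x)).

Definition left_mul_linear (M N : bimodType A) (lM : B ⊗ M -> M)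
    (lN : B ⊗ N -> N) (f : {bimod M -> N}) : Prop :=
  forall x, f (lM x) = lN ((idfun ⊗m f) x).

Definition right_mul_linear (M N : bimodType A) (rM : M ⊗ B -> M)
    (rN : N ⊗ B -> N) (f : {bimod M -> N}) : Prop :=
  forall x, f (rM x) = rN ((f ⊗m idfun) x).

(* The outer B-actions on B ⊗ B. *)
Definition lact2 : B ⊗ (B ⊗ B) -> B ⊗ B := fun x => (mu ⊗m idfun) (tassocV x).
Definition ract2 : (B ⊗ B) ⊗ B -> B ⊗ B := fun x => (idfun ⊗m mu) (tassoc x).

Definition separable : Prop :=
  exists delta : {bimod B -> B ⊗ B},
    [/\ left_mul_linear mu lact2 delta,
        right_mul_linear mu ract2 delta &
        forall b : B, mu (delta b) = b].

End SeparableRing.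

(* Main.v *)
(* Take mu := pi and delta := Delta. The two bicolinearity conditions on pi say
   precisely that Delta is right and left mu-linear. For associativity put
   gamma := eps o pi. Applying I ⊗ eps to left colinearity gives
   pi (d ⊗ e) = d_1 gamma (d_2 ⊗ e), and right colinearity gives
   Delta (pi (c ⊗ d)) = pi (c ⊗ d_1) ⊗ d_2, so that
   pi (pi (c ⊗ d) ⊗ e) = pi (c ⊗ d_1) gamma (d_2 ⊗ e)
                       = pi (c ⊗ d_1 gamma (d_2 ⊗ e)) = pi (c ⊗ pi (d ⊗ e)). *)
Require Import Defs.
From HB Require Import structures.
From mathcomp Require Import all_boot all_algebra.

Local Open Scope ring_scope.

Import GRing.Theory.

Section ColinearProduct.
Variables (A : pzRingType) (C : coringType A) (p : {bimod C ⊗ C -> C}).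

(** This is I ⊗ gamma, with C ⊗ A identified with C. *)
Definition contract (z : C ⊗ (C ⊗ C)) : C :=
  tunitr ((idfun ⊗m counit) ((idfun ⊗m p) z)).

Lemma contractD : {morph contract : x y / x + y}.
Proof. by move=> x y; rewrite /contract !raddfD. Qed.

Lemma contract_tens c x : contract (c ⊗t x) = c :* counit (p x).
Proof. by rewrite /contract !tmap_tens tunitr_tens. Qed.

Lemma left_colinear_contract :
  left_colinear (@lcoact2 A C) comul p ->
  forall x, p x = contract (lcoact2 x).
Proof. by move=> pl x; rewrite -[LHS]counitr pl. Qed.

(** On [y = u ⊗t v] both sides are [p (c ⊗t u) :* counit (p (v ⊗t e))], since [p] is right A-linear.
    Associativity uses [y = comul d]. *)
Lemma contract_map_tassocV c y e :
  contract (tassoc ((p ⊗m idfun) (tassocV (c ⊗t y)) ⊗t e)) =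
  p (c ⊗t contract (tassoc (y ⊗t e))).
Proof.
elim/tensor_ind: y => [u v|y z IHy IHz].
  rewrite tassocV_tens tmap_tens !tassoc_tens !contract_tens.
  by rewrite -rscale_tens rlinearZ.
by rewrite !(tensDl, tensDr, raddfD, contractD) /= IHy IHz.
Qed.

Lemma bicolinear_assoc :
  left_colinear (@lcoact2 A C) comul p ->
  right_colinear (@rcoact2 A C) comul p -> is_Aring p.
Proof.
move=> pl pr; elim/tensor_ind=> [t e|x y IHx IHy]; last first.
  by rewrite !raddfD /= IHx IHy.
elim/tensor_ind: t => [c d|x y IHx IHy]; last first.
  by rewrite tensDl !raddfD /= IHx IHy.
rewrite tassoc_tens !tmap_tens /=.
(* Expanding the outer product exposes [comul (p (c ⊗t d))], to which [pr] applies. *)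
rewrite (left_colinear_contract pl (p _ ⊗t e)) /lcoact2 tmap_tens /= pr /rcoact2.
rewrite tmap_tens contract_map_tassocV.
by rewrite (left_colinear_contract pl (d ⊗t e)) /lcoact2 tmap_tens.
Qed.

End ColinearProduct.

Theorem theorem2p6 (A : pzRingType) (C : coringType A) (hC : coseparable C) :
  exists mu : {bimod C ⊗ C -> C}, is_Aring mu /\ separable mu.
Proof.
have [p [pl pr pK]] := hC; exists p; split; first exact: bicolinear_assoc.
(* Left linearity of [comul] unfolds to [pr], right linearity to [pl]. *)
by exists comul; split.
Qed.
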